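(* Let $1<q<2$ and let $(\mathbf{y}_{(p)})_{p\ge0}$ be generated by the $q$PWAWS iteration (see context) from an arbitrary starting point $\mathbf{y}_{(0)}\in\mathbb{R}^d$. If $\mathbf{y}_{(p)}\ne\mathbf{M}$ for all $p$, then $\mathbf{y}_{(p)}\to\mathbf{M}$ as $p\to\infty$. If some $\mathbf{y}_{(p)}=\mathbf{M}$, this is detected: either $\mathbf{y}_{(p)}\notin\{\mathbf{x}_i\}$ and $\mathbf{T}_1(\mathbf{y}_{(p)})=\mathbf{y}_{(p)}$, or $\mathbf{y}_{(p)}=\mathbf{x}_k$ and $\nabla D_q(\mathbf{x}_k)=\mathbf{0}$.
   Context: Let $\mathbf{x}_1,\dots,\mathbf{x}_m\in\mathbb{R}^d$ be distinct data points, not all lying on a common affine line, and $\eta_1,\dots,\eta_m>0$ weights. Let $1<q<2$, $C_q(\mathbf{y})=\sum_{i=1}^m \eta_i^q\|\mathbf{y}-\mathbf{x}_i\|^q$ (Euclidean norm), strictly convex with unique minimizer $\mathbf{M}$. For $\mathbf{y}\notin\{\mathbf{x}_i\}$, $\mathbf{T}_1(\mathbf{y})=\frac{\sum_{i} \eta_i^q\|\mathbf{y}-\mathbf{x}_i\|^{q-2}\mathbf{x}_i}{\sum_{i} \eta_i^q\|\mathbf{y}-\mathbf{x}_i\|^{q-2}}$. For each $k$, $\nabla D_q(\mathbf{x}_k)=\sum_{i\ne k} q\eta_i^q\|\mathbf{x}_k-\mathbf{x}_i\|^{q-2}(\mathbf{x}_k-\mathbf{x}_i)$; $\mathbf{x}_k=\mathbf{M}$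 iff $\nabla D_q(\mathbf{x}_k)=\mathbf{0}$, and if $\nabla D_q(\mathbf{x}_k)\neq\mathbf{0}$ there exist $\lambda>0$ with $C_q(\mathbf{x}_k-\lambda\nabla D_q(\mathbf{x}_k))<C_q(\mathbf{x}_k)$. The $q$PWAWS iteration: if $\mathbf{y}_{(p)}=\mathbf{M}$ the algorithm stops; otherwise, if $\mathbf{y}_{(p)}\notin\{\mathbf{x}_i\}$ set $\mathbf{y}_{(p+1)}=\mathbf{T}_1(\mathbf{y}_{(p)})$, and if $\mathbf{y}_{(p)}=\mathbf{x}_k\neq\mathbf{M}$ set $\mathbf{y}_{(p+1)}=\mathbf{x}_k-\lambda_p\nabla D_q(\mathbf{x}_k)$, where $\lambda_p>0$ is any number with $C_q(\mathbf{x}_k-\lambda_p\nabla D_q(\mathbf{x}_k))<C_q(\mathbf{x}_k)$. *)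

(* Defs.v *)
From mathcomp Require Import all_boot all_order all_algebra.
From mathcomp Require Import all_classical all_reals all_analysis.
Set Implicit Arguments. Unset Strict Implicit. Unset Printing Implicit Defensive.
Import Order.TTheory GRing.Theory Num.Theory.
Local Open Scope ring_scope.

Section Defs.
Variables (R : realType) (d m : nat).

Definition enorm (v : 'rV[R]_d) : R := Num.sqrt (\sum_(j < d) (v 0 j) ^+ 2).

Definition Cq (q : R) (x : 'I_m -> 'rV[R]_d) (eta : 'I_m -> R) (y : 'rV[R]_d) : R :=
  \sum_(i < m) (eta i `^ q) * (enorm (y - x i) `^ q).

(* T_1(y), meaningful for y not a data point *)
Definition T1 (q : R) (x : 'I_m -> 'rV[R]_d) (eta : 'I_m -> R) (y : 'rV[R]_d)
  : 'rV[R]_d :=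
  (\sum_(i < m) (eta i `^ q) * (enorm (y - x i) `^ (q - 2)))^-1 *:
  (\sum_(i < m) ((eta i `^ q) * (enorm (y - x i) `^ (q - 2))) *: x i).

Definition gradDq (q : R) (x : 'I_m -> 'rV[R]_d) (eta : 'I_m -> R) (k : 'I_m)
  : 'rV[R]_d :=
  \sum_(i < m | i != k)
     (q * (eta i `^ q) * (enorm (x k - x i) `^ (q - 2))) *: (x k - x i).

Definition on_common_line (x : 'I_m -> 'rV[R]_d) : Prop :=
  exists (a v : 'rV[R]_d), forall i, exists t : R, x i = a + t *: v.

Definition is_data_point (x : 'I_m -> 'rV[R]_d) (y : 'rV[R]_d) : Prop :=
  exists k, y = x k.

Definition qPWAWS_step (q : R) (x : 'I_m -> 'rV[R]_d) (eta : 'I_m -> R)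
  (yp ynext : 'rV[R]_d) : Prop :=
  (~ is_data_point x yp -> ynext = T1 q x eta yp) /\
  (forall k, yp = x k ->
     exists lam : R, 0 < lam /\
       Cq q x eta (x k - lam *: gradDq q x eta k) < Cq q x eta (x k) /\
       ynext = x k - lam *: gradDq q x eta k).

End Defs.

(* Main.v *)
(* Each step from a non-data point minimizes a quadratic majorant of the cost, and
   so lowers the cost by at least half of |grad| |step|; each data point is
   visited at most once. By convexity the gradient is bounded away from zero as
   long as the cost stays above its minimum. The steps then tend to zero, which
   forces the iterates towards the data points; but since q > 1 a data point
   other than the minimizer repels nearby iterates. Hence the cost tends to its
   minimum, and compactness and strict convexity give convergence to the
   minimizer. *)

Require Import Defs.
From mathcomp Require Import all_boot all_order all_algebra.
From mathcomp Require Import all_classical all_reals all_analysis.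
From mathcomp Require Import ring lra.
Set Implicit Arguments. Unset Strict Implicit. Unset Printing Implicit Defensive.
Import Order.TTheory GRing.Theory Num.Theory.
Import numFieldNormedType.Exports.
Local Open Scope ring_scope.
Local Open Scope classical_set_scope.

(** * Inequalities for real powers *)

Section RealPowers.
Variable R : realType.
Implicit Types a b t th q r e : R.

(* Weighted AM-GM for [t] and [1]: compare the logarithms of both with that of
   their weighted mean. *)
Lemma powR_lt_chord th t : 0 < th -> th < 1 -> 0 <= t -> t != 1 ->
  t `^ th < th * t + (1 - th).
Proof.
move=> th0 th1; rewrite le_eqVlt => /orP[/eqP <- _|t0 t1].
  by rewrite powR0 ?gt_eqF// mulr0 add0r subr_gt0.
set A := _ + _; have A0 : 0 < A by rewrite addr_gt0 ?mulr_gt0// subr_gt0.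
have A1 : A != 1.
  rewrite -subr_eq0 (_ : A - 1 = th * (t - 1)); last by rewrite /A; ring.
  by rewrite mulf_neq0 ?subr_eq0// gt_eqF.
rewrite /powR gt_eqF// -[ltRHS]lnK ?posrE// ltr_expR.
have u : 1 + (ln t - ln A) <= t / A.
  by rewrite (le_trans (expR_ge1Dx _))// expRD expRN !lnK ?posrE.
have v : 1 + - ln A < A^-1.
  by rewrite (lt_le_trans (expR_gt1Dx _))// ?oppr_eq0 ?ln_eq0// expRN lnK ?posrE.
have /(ler_wpM2l (ltW th0)) {}u := u.
have {}v : (1 - th) * (1 + - ln A) < (1 - th) * A^-1.
  by rewrite ltr_pM2l// subr_gt0.
have : th * (t / A) + (1 - th) * A^-1 = 1 by rewrite mulrA -mulrDl mulfV ?gt_eqF.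
by move: u v; set p := th * (t / A); set s := (1 - th) * A^-1; nra.
Qed.

Lemma powR_sub1 q a : 0 < a -> a `^ (q - 1) = a `^ (q - 2) * a.
Proof.
move=> a0; rewrite -{3}(powRr1 (ltW a0)) -powRD ?(gt_eqF a0) ?implybT//.
by congr powR; ring.
Qed.

Lemma powR_sub2 q a : 0 < a -> a `^ q = a `^ (q - 2) * a ^+ 2.
Proof.
move=> a0; rewrite -(powR_mulrn 2 (ltW a0)) -powRD ?(gt_eqF a0) ?implybT//.
by rewrite subrK.
Qed.

(** Bernoulli's inequality: [powR_lt_chord] with exponent [q^-1] at the [q]-th power of [b / a],
    rescaled. The derivative is written q a^(q - 2) a to fit the weights of the gradient. *)
Lemma powR_gt_tangent q a b : 1 < q -> 0 < a -> 0 <= b -> b != a ->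
  a `^ q + q * (a `^ (q - 2) * a) * (b - a) < b `^ q.
Proof.
move=> q1 a0 b0 ba; have q0 : 0 < q by lra.
have ba0 : 0 <= b / a by rewrite divr_ge0// ltW.
have := @powR_lt_chord q^-1 ((b / a) `^ q).
rewrite invr_gt0 invf_lt1// powR_ge0 powR_eq1 (gt_eqF q0) orbF.
rewrite (le_gtF ba0) orbF -powRrM mulfV ?(gt_eqF q0)// powRr1//.
rewrite -subr_eq0 (_ : b / a - 1 = (b - a) / a); last by field; rewrite gt_eqF.
rewrite mulf_neq0 ?invr_eq0 ?subr_eq0 ?(gt_eqF a0)//.
move=> /(_ q0 q1 isT isT); rewrite powRM ?invr_ge0 ?(ltW a0)//.
have -> : a^-1 `^ q = (a `^ q)^-1 by rewrite -powR_inv1 ?ltW// -powRrM mulN1r powRN.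
rewrite -(ltr_pM2l (mulr_gt0 q0 (powR_gt0 q a0))).
rewrite -powR_sub1//.
have -> : q * a `^ q * (b / a) = q * a `^ (q - 1) * b.
  by rewrite powR_sub1// (@powR_sub2 q)//; field; rewrite gt_eqF.
have -> : q * a `^ q * (q^-1 * (b `^ q / a `^ q) + (1 - q^-1)) =
   b `^ q + (q - 1) * a `^ q.
  by field; rewrite !gt_eqF// powR_gt0.
have : q * a `^ (q - 1) * a = q * a `^ q.
  by rewrite powR_sub1// (@powR_sub2 q)//; ring.
nra.
Qed.

(** Concavity in the squared variable: [powR_lt_chord] with exponent [q / 2] at the square of
    [b / a]. Being quadratic in [b], the bound leads to a majorant with an explicit minimizer. *)
Lemma powR_le_quadratic q a b : 0 < q -> q < 2 -> 0 < a -> 0 <= b ->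
  b `^ q <= a `^ q + q / 2 * a `^ (q - 2) * (b ^+ 2 - a ^+ 2).
Proof.
move=> q0 q2 a0 b0; have ba0 : 0 <= b / a by rewrite divr_ge0// ltW.
have h : (b / a) `^ q <= q / 2 * (b / a) ^+ 2 + (1 - q / 2).
  have -> : (b / a) `^ q = ((b / a) ^+ 2) `^ (q / 2).
    by rewrite -powR_mulrn// -powRrM; congr powR; field.
  have [->|t1] := eqVneq ((b / a) ^+ 2) 1; first by rewrite powR1; lra.
  by apply/ltW/powR_lt_chord; rewrite ?exprn_ge0//; lra.
have := ler_wpM2l (powR_ge0 a q) h.
rewrite -powRM ?(ltW a0)// (mulrC a) divfK ?gt_eqF// => /le_trans; apply.
by rewrite (@powR_sub2 q)// le_eqVlt; apply/orP; left; apply/eqP; field; rewrite gt_eqF.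
Qed.

Lemma powR_small e r : 0 < e -> 0 < r -> exists2 t, 0 < t <= 1 & t `^ r <= e.
Proof.
move=> e0 r0; exists (Num.min 1 (e `^ r^-1)).
  by rewrite ge_min lexx lt_min ltr01 powR_gt0.
have {2}<- : (e `^ r^-1) `^ r = e by rewrite -powRrM mulVf ?powRr1 ?gt_eqF ?ltW.
by rewrite ge0_ler_powR ?(ltW r0)// ?nnegrE ?le_min ?powR_ge0 ?ler01// ge_min lexx orbT.
Qed.

End RealPowers.

(** * Euclidean inner product and norm, and powers of the norm *)

Section EuclideanNorm.
Variables (R : realType) (d : nat).
Implicit Types (u v h : 'rV[R]_d) (a q : R).

Definition dot u v : R := \sum_(j < d) u 0 j * v 0 j.

Lemma dotC u v : dot u v = dot v u.
Proof. by apply: eq_bigr => j _; rewrite mulrC. Qed.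

Lemma dotDl u v h : dot (u + v) h = dot u h + dot v h.
Proof. by rewrite -big_split; apply: eq_bigr => j _; rewrite mxE mulrDl. Qed.

Lemma dotDr u v h : dot h (u + v) = dot h u + dot h v.
Proof. by rewrite dotC dotDl !(dotC h). Qed.

Lemma dotZl a u v : dot (a *: u) v = a * dot u v.
Proof. by rewrite mulr_sumr; apply: eq_bigr => j _; rewrite mxE mulrA. Qed.

Lemma dotZr a u v : dot u (a *: v) = a * dot u v.
Proof. by rewrite dotC dotZl dotC. Qed.

Lemma dotNr u v : dot u (- v) = - dot u v.
Proof. by rewrite -scaleN1r dotZr mulN1r. Qed.

Lemma dot0l v : dot 0 v = 0.
Proof. by rewrite -(scale0r 0) dotZl mul0r. Qed.

Lemma dot_suml (I : finType) (F : I -> 'rV[R]_d) v :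
  dot (\sum_i F i) v = \sum_i dot (F i) v.
Proof.
by apply: (big_morph (fun u => dot u v)) => [? ?|]; rewrite ?dotDl ?dot0l.
Qed.

Lemma enorm_ge0 v : 0 <= enorm v.
Proof. exact: sqrtr_ge0. Qed.

Lemma enorm_sqr v : enorm v ^+ 2 = dot v v.
Proof.
rewrite sqr_sqrtr; first by apply: eq_bigr => j _; rewrite expr2.
by apply: sumr_ge0 => j _; rewrite sqr_ge0.
Qed.

Lemma enorm_eq0 v : (enorm v == 0) = (v == 0).
Proof.
rewrite -(sqrf_eq0 (enorm v)) enorm_sqr; apply/eqP/eqP => [/eqP|->]; last exact: dot0l.
rewrite psumr_eq0 => [|j _]; last by rewrite -expr2 sqr_ge0.
move=> /allP z; apply/rowP => j; rewrite mxE.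
by have := z j (mem_index_enum j); rewrite mulf_eq0 orbb => /eqP.
Qed.

Lemma enorm_gt0 v : (0 < enorm v) = (v != 0).
Proof. by rewrite lt_def enorm_ge0 andbT enorm_eq0. Qed.

Lemma enorm0 : enorm (0 : 'rV[R]_d) = 0.
Proof. by apply/eqP; rewrite enorm_eq0. Qed.

Lemma enormZ a v : enorm (a *: v) = `|a| * enorm v.
Proof.
apply/eqP; rewrite -(eqrXn2 (n := 2)) ?mulr_ge0 ?enorm_ge0// exprMn !enorm_sqr.
by rewrite dotZl dotZr -normrX ger0_norm ?sqr_ge0// mulrA expr2.
Qed.

Lemma enormN v : enorm (- v) = enorm v.
Proof. by rewrite -scaleN1r enormZ normrN1 mul1r. Qed.

Lemma enorm_sqrD u v :
  enorm (u + v) ^+ 2 = enorm u ^+ 2 + 2 * dot u v + enorm v ^+ 2.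
Proof. by rewrite !enorm_sqr !(dotDl, dotDr) (dotC v u); ring. Qed.

(** Cauchy-Schwarz: for nonzero vectors, expand the squared norm of
    [enorm v *: u - enorm u *: v]. *)
Lemma dot_le u v : dot u v <= enorm u * enorm v.
Proof.
have [->|u0] := eqVneq u 0; first by rewrite dot0l mulr_ge0 ?enorm_ge0.
have [->|v0] := eqVneq v 0; first by rewrite dotC dot0l mulr_ge0 ?enorm_ge0.
have := sqr_ge0 (enorm (enorm v *: u + (- enorm u) *: v)).
rewrite enorm_sqrD !enormZ normrN !ger0_norm ?enorm_ge0// dotZl dotZr.
have : 0 < enorm u * enorm v by rewrite mulr_gt0 ?enorm_gt0.
by move: (dot u v) (enorm u) (enorm v) => p a b; nra.
Qed.

Lemma enorm_triangle u v : enorm (u + v) <= enorm u + enorm v.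
Proof.
rewrite -(ler_pXn2r (n := 2)) ?nnegrE ?addr_ge0 ?enorm_ge0// enorm_sqrD.
by have := dot_le u v; nra.
Qed.

(** Combines the scalar tangent bound with Cauchy-Schwarz. Strictness comes from the scalar bound if
    the norm changes; otherwise [dot v h] is minus half of |h|^2, hence negative. *)
Lemma powR_enorm_gt_tangent q v h : 1 < q -> h != 0 ->
  enorm v `^ q + q * enorm v `^ (q - 2) * dot v h < enorm (v + h) `^ q.
Proof.
move=> q1 h0; have [->|v0] := eqVneq v 0.
  by rewrite enorm0 powR0 ?gt_eqF ?(lt_trans ltr01)// dot0l mulr0 addr0 add0r
    powR_gt0// enorm_gt0.
have a0 : 0 < enorm v by rewrite enorm_gt0.
have dh : dot v h <= enorm v * (enorm (v + h) - enorm v).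
  by have := dot_le v (v + h); rewrite dotDr -enorm_sqr; nra.
have s0 : 0 < q * enorm v `^ (q - 2) by rewrite mulr_gt0 ?powR_gt0//; lra.
have [e|ne] := eqVneq (enorm (v + h)) (enorm v); last first.
  apply: le_lt_trans (powR_gt_tangent q1 a0 (enorm_ge0 _) ne).
  by rewrite lerD2l mulrA -[leRHS]mulrA ler_pM2l.
rewrite e gtrDl pmulr_rlt0//.
have := enorm_sqrD v h; rewrite e.
have : 0 < enorm h ^+ 2 by rewrite exprn_gt0// enorm_gt0.
nra.
Qed.

(** At [v = 0] the default value 0^(q - 2) = 0 removes the middle terms, and the last term is the
    exact value. *)
Lemma powR_enorm_le_quadratic q v h : 0 < q -> q < 2 ->
  enorm (v + h) `^ q <= enorm v `^ q + q * enorm v `^ (q - 2) * dot v h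
     + q / 2 * enorm v `^ (q - 2) * enorm h ^+ 2 + (v == 0)%:R * enorm h `^ q.
Proof.
move=> q0 q2; have [->|v0] := eqVneq v 0.
  rewrite enorm0 add0r (powR0 (_ : q - 2 != 0)); last by lra.
  by rewrite powR0 ?gt_eqF// !mulr0 !mul0r mul1r !add0r.
have a0 : 0 < enorm v by rewrite enorm_gt0.
apply: le_trans (powR_le_quadratic q0 q2 a0 (enorm_ge0 _)) _.
by rewrite enorm_sqrD mul0r addr0 le_eqVlt; apply/orP; left; apply/eqP; field.
Qed.

End EuclideanNorm.

(** * First-order bounds for the cost, and optimality at the minimizer *)

Section WeiszfeldCost.
Variables (R : realType) (d m : nat) (x : 'I_m -> 'rV[R]_d) (eta : 'I_m -> R).
Variable q : R.
Hypotheses (eta_gt0 : forall i, 0 < eta i) (q_gt1 : 1 < q) (q_lt2 : q < 2).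
Implicit Types (y z h M : 'rV[R]_d) (i k : 'I_m).

Let q_gt0 : 0 < q. Proof. exact: lt_trans q_gt1. Qed.

(* At a data point [0 `^ (q - 2) = 0] drops the singular term, so that
   [q *: half_grad y] is the gradient of [Cq] off the data and [gradDq] on them. *)
Definition weight y i := eta i `^ q * enorm (y - x i) `^ (q - 2).
Definition mass y := \sum_i weight y i.
Definition half_grad y := \sum_i weight y i *: (y - x i).
Definition total_weight := \sum_i eta i `^ q.

Lemma weight_ge0 y i : 0 <= weight y i.
Proof. by rewrite mulr_ge0 ?powR_ge0. Qed.

Lemma mass_gt0 i y : ~ is_data_point x y -> 0 < mass y.
Proof.
move=> yx; rewrite /mass (bigD1 i)//= ltr_pwDl ?sumr_ge0// => [|j _].
  rewrite mulr_gt0 ?powR_gt0// enorm_gt0 subr_eq0.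
  by apply/eqP => e; apply: yx; exists i.
exact: weight_ge0.
Qed.

Lemma total_weight_gt0 i : 0 < total_weight.
Proof.
rewrite /total_weight (bigD1 i)//= ltr_pwDl ?sumr_ge0// ?powR_gt0// => j _.
exact: powR_ge0.
Qed.

(** The exponent [q - 2] is negative, so small distances give the large weights. *)
Lemma mass_le y r : 0 < r -> (forall i, r <= enorm (y - x i)) ->
  mass y <= total_weight * r `^ (q - 2).
Proof.
move=> r0 ry; rewrite /mass mulr_suml ler_sum// => i _.
rewrite ler_wpM2l ?powR_ge0// -(opprB 2) !powRN lef_pV2 ?posrE ?powR_gt0//.
  by rewrite ge0_ler_powR ?nnegrE ?enorm_ge0 ?(ltW r0)// subr_ge0 ltW.
exact: lt_le_trans (ry i).
Qed.

(** The map [T1] is a gradient step along [half_grad y] whose step size is the inverse of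
    [mass y]. *)
Lemma mass_T1 i y : ~ is_data_point x y ->
  mass y *: (y - T1 q x eta y) = half_grad y.
Proof.
move=> yx; rewrite scalerBr scalerA mulfV ?gt_eqF ?(mass_gt0 i)// scale1r.
rewrite scaler_suml -sumrB; apply: eq_bigr => j _.
by rewrite scalerBr.
Qed.

Lemma half_grad_data k : q *: half_grad (x k) = gradDq q x eta k.
Proof.
rewrite /half_grad /gradDq (bigD1 k)//= [x k - x k]subrr scaler0 add0r scaler_sumr.
by apply: eq_bigr => i _; rewrite scalerA mulrA.
Qed.

(** The strict tangent bounds of the terms add up, also at a data point, where the singular term has
    derivative zero. The index [i] makes the sum nonempty, as strictness requires. *)
Lemma Cq_gt_tangent i y z : z != y ->
  Cq q x eta y + q * dot (half_grad y) (z - y) < Cq q x eta z.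
Proof.
move=> zy; rewrite dot_suml mulr_sumr -big_split/=.
apply: ltr_sum => [|j _]; first by apply/hasP; exists i; rewrite ?mem_index_enum.
have := @powR_enorm_gt_tangent _ _ q (y - x j) (z - y) q_gt1.
rewrite subr_eq0 => /(_ zy); rewrite [y - _ + _]addrC subrKA => T.
rewrite -(ltr_pM2l (powR_gt0 q (eta_gt0 j))) in T; apply: le_lt_trans T.
by rewrite dotZl /weight le_eqVlt; apply/orP; left; apply/eqP; ring.
Qed.

(** The last sum collects the terms centred at [y] itself: they grow like |h|^q and have no
    quadratic majorant near [h = 0]. *)
Lemma Cq_le_quadratic y h :
  Cq q x eta (y + h) <= Cq q x eta y + q * dot (half_grad y) h
    + q / 2 * mass y * enorm h ^+ 2
    + (\sum_(i | y == x i) eta i `^ q) * enorm h `^ q.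
Proof.
rewrite [\sum_(i | y == x i) _]big_mkcond dot_suml mulr_sumr [q / 2 * _]mulr_sumr.
rewrite !mulr_suml -!big_split/=.
apply: ler_sum => i _.
have := @powR_enorm_le_quadratic _ _ q (y - x i) h q_gt0 q_lt2.
rewrite [y - _ + _]addrAC subr_eq0 => T.
rewrite -(ler_pM2l (powR_gt0 q (eta_gt0 i))) in T; apply: le_trans T _.
rewrite dotZl /weight le_eqVlt; apply/orP; left; apply/eqP.
move: (eta i `^ q) (enorm (y - x i) `^ q) (enorm (y - x i) `^ (q - 2)) => w a b.
move: (dot _ _) (enorm h) (enorm h `^ q) => g e eq.
by case: (y == x i) => /=; ring.
Qed.

(** [T1] minimizes the quadratic majorant: by [mass_T1], the linear term there is minus twice the
    quadratic one. *)
Lemma T1_descent i y : ~ is_data_point x y ->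
  Cq q x eta (T1 q x eta y)
    <= Cq q x eta y - q / 2 * (mass y * enorm (T1 q x eta y - y) ^+ 2).
Proof.
move=> yx; have := Cq_le_quadratic y (T1 q x eta y - y).
rewrite subrKC big1 => [|j /eqP yj]; last by case: yx; exists j.
rewrite mul0r addr0 -(mass_T1 i yx) dotZl -(opprB y) enormN.
rewrite dotNr -enorm_sqr => /le_trans; apply.
by rewrite le_eqVlt; apply/orP; left; apply/eqP; field.
Qed.

(** Moving a distance [t] against a nonzero gradient gains a multiple of [t] and loses at most
    multiples of t^2 and t^q. Since q > 1, the gain wins for small [t], at data points too. *)
Lemma min_half_grad M : (forall z, Cq q x eta M <= Cq q x eta z) ->
  half_grad M = 0.
Proof.
move=> minM; apply/eqP; rewrite -enorm_eq0; apply/negP => /negP g0.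
set g := enorm _ in g0; have {}g0 : 0 < g by rewrite lt_def g0 enorm_ge0.
set W := \sum_(i | M == x i) eta i `^ q.
have W0 : 0 <= W by apply: sumr_ge0 => i _; exact: powR_ge0.
have S0 : 0 <= mass M by apply: sumr_ge0 => i _; exact: weight_ge0.
(* As t^2 <= t^q for t <= 1, the loss is at most K t^q; the bound imposed on t^(q - 1) keeps this
   within half of the gain. *)
pose K := q / 2 * mass M + W + 1.
have K0 : 0 < K by rewrite ltr_wpDl// addr_ge0// mulr_ge0// ltW// divr_gt0.
have [||t /andP[t0 t1] tK] := @powR_small R (q * g / (2 * K)) (q - 1).
- by rewrite !(divr_gt0, mulr_gt0).
- by rewrite subr_gt0.
have := Cq_le_quadratic M (- (t / g) *: half_grad M).
rewrite enormZ normrN gtr0_norm ?divr_gt0// -/g divfK ?gt_eqF//.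
rewrite dotZr -enorm_sqr -/g -/W => /(le_trans (minM _)).
rewrite (_ : - (t / g) * g ^+ 2 = - (t * g)); last by field; rewrite gt_eqF.
have tq : t `^ q = t `^ (q - 1) * t.
  by rewrite powR_sub1// (@powR_sub2 _ q)//; ring.
have t2 : t ^+ 2 <= t `^ q.
  by rewrite -(powR_mulrn 2 (ltW t0)) ger_powR// ?t0// ltW.
have {}tK : K * t `^ q <= q * g / 2 * t.
  rewrite tq mulrA ler_pM2r//.
  apply: le_trans (ler_wpM2l (ltW K0) tK) _.
  by rewrite le_eqVlt; apply/orP; left; apply/eqP; field; rewrite gt_eqF.
have : q / 2 * mass M * t ^+ 2 <= q / 2 * mass M * t `^ q.
  by rewrite ler_wpM2l// mulr_ge0// ltW// divr_gt0.
have : 0 < q * g * t by rewrite !mulr_gt0.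
have := powR_gt0 q t0.
by move: tK; rewrite /K; lra.
Qed.

Lemma half_grad_min_lt i M z : half_grad M = 0 -> z != M ->
  Cq q x eta M < Cq q x eta z.
Proof. by move=> g0 /(Cq_gt_tangent i); rewrite g0 dot0l mulr0 addr0. Qed.

(** Both alternatives restate that [half_grad] vanishes at [M]: through [mass_T1] off the data,
    through [half_grad_data] on them. *)
Lemma min_detected i M : (forall z, Cq q x eta M <= Cq q x eta z) ->
  (~ is_data_point x M /\ T1 q x eta M = M) \/
  (exists k, M = x k /\ gradDq q x eta k = 0).
Proof.
move=> /min_half_grad g0; have [[k Mk]|Mx] := pselect (is_data_point x M).
  by right; exists k; split=> //; rewrite -half_grad_data -Mk g0 scaler0.
left; split=> //; have := mass_T1 i Mx; rewrite g0 => /eqP.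
by rewrite scaler_eq0 gt_eqF ?(mass_gt0 i)//= subr_eq0 => /eqP.
Qed.

(** The single term of index [i] already controls the distance to [x i]; the added 1 keeps [L]
    positive. *)
Lemma Cq_sublevel i c :
  exists2 L, 0 < L & forall z, Cq q x eta z <= c -> enorm (z - x i) <= L.
Proof.
exists ((c / eta i `^ q) `^ q^-1 + 1) => [|z zc].
  by rewrite ltr_wpDl ?powR_ge0.
have e : enorm (z - x i) = (enorm (z - x i) `^ q) `^ q^-1.
  by rewrite -powRrM mulfV ?powRr1 ?enorm_ge0 ?gt_eqF.
have zi : enorm (z - x i) `^ q <= c / eta i `^ q.
  rewrite ler_pdivlMr ?powR_gt0// mulrC (le_trans _ zc)//.
  rewrite /Cq (bigD1 i)//= lerDl sumr_ge0// => j _.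
  by rewrite mulr_ge0 ?powR_ge0.
rewrite e ler_wpDr// ge0_ler_powR ?nnegrE ?powR_ge0 ?invr_ge0 ?(ltW q_gt0)//.
by rewrite (le_trans _ zi)// powR_ge0.
Qed.

End WeiszfeldCost.

(** * Continuity of the norm and compactness of bounded closed sets *)

Section EuclideanTopology.
Variables (R : realType) (d : nat).
Implicit Types (v c : 'rV[R]_d) (r : R).

Lemma enorm_continuous : continuous (@enorm R d).
Proof.
move=> v; apply: continuous_comp; last exact: sqrt_continuous.
have /(_ v) : continuous (fun u : 'rV[R]_d => \sum_j u 0 j ^+ 2); last exact.
apply: continuous_big => [|j _ u]; first exact: add_continuous.
exact: (continuous_comp (@coord_continuous _ _ _ _ _ u) (@exprn_continuous R 2 _)).
Qed.

Lemma enorm_sub_continuous c : continuous (fun v => enorm (v - c)).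
Proof.
move=> v; have vc : {for v, continuous (fun u : 'rV[R]_d => u - c)}.
  by apply: continuousB; [exact: cvg_id|exact: cst_continuous].
exact: (continuous_comp vc (@enorm_continuous _)).
Qed.

Lemma coord_le_enorm v j : `|v 0 j| <= enorm v.
Proof.
rewrite -(ler_pXn2r (n := 2)) ?nnegrE ?enorm_ge0// -normrX ger0_norm ?sqr_ge0//.
rewrite enorm_sqr /dot (bigD1 j)//= -expr2 lerDl sumr_ge0// => k _.
by rewrite -expr2 sqr_ge0.
Qed.

(** A Euclidean ball lies in a product of coordinate segments, which is compact. *)
Lemma enorm_bounded_compact (A : set 'rV[R]_d) c r : closed A ->
  (forall v, A v -> enorm (v - c) <= r) -> compact A.
Proof.
move=> Acl Ar; pose I j := `[c 0 j - r, c 0 j + r]%classic.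
apply: (subclosed_compact Acl (@rV_compact _ _ I _)) => [j|v /Ar vr j].
  exact: segment_compact.
have := le_trans (coord_le_enorm _ j) vr.
by rewrite !mxE ler_norml /I /= in_itv/= => /andP[? ?]; apply/andP; split; lra.
Qed.

End EuclideanTopology.

(** * Continuity of the cost and its gap away from the minimizer *)

Section CostGap.
Variables (R : realType) (d m : nat) (x : 'I_m -> 'rV[R]_d) (eta : 'I_m -> R).
Variable q : R.
Hypotheses (eta_gt0 : forall i, 0 < eta i) (q_gt1 : 1 < q) (q_lt2 : q < 2).

(** The tangent bounds the difference from below, the quadratic majorant from above; within distance
    1 the powers h^2 and h^q are at most h. *)
Lemma Cq_locally_lipschitz (i : 'I_m) y : exists2 K, 0 < K &
  forall z, enorm (z - y) <= 1 ->
    `|Cq q x eta z - Cq q x eta y| <= K * enorm (z - y).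
Proof.
set G := half_grad x eta q y; set S := mass x eta q y.
set N := \sum_(i | y == x i) eta i `^ q.
have S0 : 0 <= S by apply: sumr_ge0 => j _; exact: weight_ge0.
have N0 : 0 <= N by apply: sumr_ge0 => j _; exact: powR_ge0.
have G0 : 0 <= enorm G := enorm_ge0 _.
have q0 : 0 < q := lt_trans ltr01 q_gt1.
have q20 : 0 <= q / 2 by lra.
exists (q * enorm G + q / 2 * S + N + 1) => [|z zy1].
  by have := mulr_ge0 (ltW q0) G0; have := mulr_ge0 q20 S0; lra.
have [->|zy] := eqVneq z y; first by rewrite !subrr normr0 enorm0 mulr0.
have := Cq_le_quadratic x eta_gt0 q_gt1 q_lt2 y (z - y).
have := Cq_gt_tangent x eta_gt0 q_gt1 i zy.
rewrite subrKC -/G -/S -/N.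
set h := enorm _ in zy1 *; have h0 : 0 < h by rewrite enorm_gt0 subr_eq0.
have h2 : h ^+ 2 <= h by rewrite expr2 ler_piMl// ltW.
have hq : h `^ q <= h by rewrite ge1r_powR ?h0// ltW.
have d1 : q * dot G (z - y) <= q * enorm G * h.
  by rewrite -mulrA ler_pM2l ?dot_le.
have d2 : - (q * dot G (z - y)) <= q * enorm G * h.
  by rewrite -mulrN -dotNr -mulrA ler_pM2l// /h -(enormN (z - y)) dot_le.
have e1 : q / 2 * S * h ^+ 2 <= q / 2 * S * h.
  by rewrite ler_wpM2l// mulr_ge0//; lra.
have e2 : N * h `^ q <= N * h by rewrite ler_wpM2l.
have e3 : 0 <= q / 2 * S * h by rewrite mulr_ge0 ?(ltW h0)// mulr_ge0//; lra.
have e4 : 0 <= N * h by rewrite mulr_ge0// ltW.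
move: (Cq _ _ _ _) (Cq _ _ _ _) => Cz Cy lo up; rewrite ler_norml !mulrDl mul1r.
move: lo up d1 d2 e1 e2 e3 e4.
move: (q * dot G _) (q * enorm G * h) (q / 2 * S * h ^+ 2) (q / 2 * S * h).
move: (N * h `^ q) (N * h) => a b c e f g lo up d1 d2 e1 e2 e3 e4.
clearbody h; clear -h0 lo up d1 d2 e1 e2 e3 e4.
by apply/andP; split; lra.
Qed.

Lemma Cq_continuous (i : 'I_m) : continuous (Cq q x eta).
Proof.
move=> y; have [K K0 HK] := Cq_locally_lipschitz i y.
apply/(@cvgrPdist_lt _ R _ (nbhs y)) => e e0.
have := @enorm_sub_continuous R d y y; rewrite /continuous_at subrr enorm0.
move/(@cvgrPdist_lt _ R _ (nbhs y)) => /(_ (Num.min 1 (e / K))).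
rewrite lt_min ltr01 divr_gt0// => /(_ isT); apply: filterS => z.
rewrite sub0r normrN ger0_norm ?enorm_ge0// lt_min => /andP[z1 ze].
rewrite distrC (le_lt_trans (HK z (ltW z1)))//.
by rewrite mulrC -ltr_pdivlMr.
Qed.

(** The sublevel set outside the ball of radius [e] around [M] lies in a compact set avoiding [M];
    there the cost attains a minimum, strictly above its value at [M]. *)
Lemma Cq_gap (i : 'I_m) M c e : half_grad x eta q M = 0 -> 0 < e ->
  exists2 gam, 0 < gam & forall z, Cq q x eta z <= c -> e <= enorm (z - M) ->
    Cq q x eta M + gam <= Cq q x eta z.
Proof.
move=> GM e0; have [L L0 HL] := Cq_sublevel x eta_gt0 q_gt1 i c.
pose A := (fun z => enorm (z - x i)) @^-1` [set t | t <= L] `&`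
          (fun z => enorm (z - M)) @^-1` [set t | e <= t].
have Acl : closed A.
  by apply: closedI; apply: preimage_closed => [z _|];
    [exact: enorm_sub_continuous|exact: closed_le
    |exact: enorm_sub_continuous|exact: closed_ge].
have Aco : compact A by apply: (enorm_bounded_compact (c := x i) (r := L)) => // z [].
(* For empty [A] the claim is vacuous and any positive gap serves. *)
have [A0|/set0P/negP/negPn/eqP A0] := pselect (A !=set0); last first.
  exists 1 => // z /HL zL ez; suff : set0 z by [].
  by rewrite -A0.
have [|z0 /set_mem[_ /= z0e] z0min] := @compact_EVT_min _ _ (Cq q x eta) A A0 Aco.
  by apply: continuous_subspaceT => z; exact: Cq_continuous.
have z0M : z0 != M.
  by apply/eqP => z0M; move: z0e; rewrite z0M subrr enorm0 leNgt e0.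
exists (Cq q x eta z0 - Cq q x eta M) => [|z /HL zL ez].
  by rewrite subr_gt0 (half_grad_min_lt eta_gt0 q_gt1 i).
by rewrite subrKC z0min//; apply/mem_set.
Qed.

End CostGap.

(** * Monotone real sequences and finite families of positive reals *)

Section Sequences.
Variable R : realType.

(** Once a value is within [e] of the infimum, no later drop can reach [e]. *)
Lemma nonincreasing_decrement (c : nat -> R) (b e : R) :
  (forall p, c p.+1 <= c p) -> (forall p, b <= c p) -> 0 < e ->
  exists N, forall p, (N <= p)%N -> c p - c p.+1 < e.
Proof.
move=> cS cb e0; have /nonincreasing_seqP cn := cS.
have [|_ [N _ <-] cN] := @inf_adherent _ (range c) _ e0.
  by split; [exists (c 0%N), 0%N|exists b => _ [p _ <-]].
exists N => p Np; have := cn _ _ Np.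
have : inf (range c) <= c p.+1.
  by apply: ge_inf; [exists b => _ [k _ <-]|exists p.+1].
lra.
Qed.

(** The default 1 of the minimum keeps it positive when [P] selects nothing. *)
Lemma finite_pos_lower_bound (I : finType) (P : pred I) (f : I -> R) :
  (forall i, P i -> 0 < f i) ->
  exists2 s, 0 < s & forall i, P i -> s <= f i.
Proof.
move=> f0; exists (\big[Num.min/1]_(i | P i) f i).
  exact: lt_bigmin ltr01 f0.
by move=> i Pi; exact: bigmin_le_cond.
Qed.

End Sequences.

(** * Monotone cost, repulsion by data points, and convergence of the iterates *)

Section Iteration.
Variables (R : realType) (d m : nat) (x : 'I_m -> 'rV[R]_d) (eta : 'I_m -> R).
Variables (q : R) (M : 'rV[R]_d) (y : nat -> 'rV[R]_d) (i0 : 'I_m).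
Hypotheses (x_inj : injective x) (eta_gt0 : forall i, 0 < eta i).
Hypotheses (q_gt1 : 1 < q) (q_lt2 : q < 2).
Hypothesis M_min : forall z, Cq q x eta M <= Cq q x eta z.
Hypothesis y_step : forall p, qPWAWS_step q x eta (y p) (y p.+1).

Let C := Cq q x eta.
Let q_gt0 : 0 < q := lt_trans ltr01 q_gt1.

Lemma Cq_data_lt p k : y p = x k -> C (y p.+1) < C (x k).
Proof. by move=> /(proj2 (y_step p))[lam [_ [lt ->]]]. Qed.

Lemma Cq_stepE p : ~ is_data_point x (y p) ->
  C (y p.+1) <= C (y p) - q / 2 * (mass x eta q (y p) * enorm (y p.+1 - y p) ^+ 2).
Proof.
by move=> yx; rewrite (proj1 (y_step p) yx); exact: (T1_descent eta_gt0 q_gt1 q_lt2 i0).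
Qed.

Lemma Cq_step_le p : C (y p.+1) <= C (y p).
Proof.
have [[k yk]|yx] := pselect (is_data_point x (y p)).
  by rewrite yk ltW// Cq_data_lt.
rewrite (le_trans (Cq_stepE yx))// gerBl mulr_ge0 ?divr_ge0 ?(ltW q_gt0)//.
by rewrite mulr_ge0 ?sqr_ge0// ltW// (mass_gt0 q eta_gt0 i0).
Qed.

Lemma Cq_iter_le n p : (n <= p)%N -> C (y p) <= C (y n).
Proof.
by have /nonincreasing_seqP : forall n, C (y n.+1) <= C (y n) := Cq_step_le; apply.
Qed.

(** After a visit to [x k] the cost falls strictly below that of [x k] and never rises again, so no
    second visit occurs; there are finitely many [k]. *)
Lemma eventually_off_data : exists N, forall p, (N <= p)%N -> ~ is_data_point x (y p).
Proof.
have /choice[N HN] : forall k, exists N, forall p, (N <= p)%N -> y p <> x k.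
  move=> k; have [[n yn]|no] := pselect (exists n, y n = x k); last first.
    by exists 0%N => p _ yp; apply: no; exists p.
  exists n.+1 => p /Cq_iter_le np yp.
  by have := le_lt_trans np (Cq_data_lt yn); rewrite yp ltxx.
exists (\max_k N k) => p Np [k]; apply: HN; exact: leq_trans (leq_bigmax k) Np.
Qed.

(* Were the gap to persist, the gradient would stay bounded away from zero; the
   decrement then forces the iterates into ever smaller balls around the data
   points, but there the step is at least twice the distance to the nearest data
   point, so this distance cannot decrease. *)
Lemma cost_gap_absurd gam : 0 < gam -> ~ (forall p, C M + gam <= C (y p)).
Proof.
move=> gam0 gap.
have [L L0 HL] := Cq_sublevel x eta_gt0 q_gt1 i0 (C (y 0%N)).
have yM p : enorm (y p - M) <= 2 * L.
  have -> : y p - M = (y p - x i0) + - (M - x i0) by rewrite opprB subrKA.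
  rewrite (le_trans (enorm_triangle _ _))// enormN mulr_natl mulr2n lerD//.
  - by apply: HL; exact: Cq_iter_le.
  - exact: HL.
(* The tangent bound at [y p], evaluated at [M], gives gam < q <G, y p - M> <= q |G| 2L, hence the
   lower bound [kap] on |G|. *)
pose kap := gam / (q * (2 * L)).
have kap0 : 0 < kap by rewrite divr_gt0// !mulr_gt0.
have G_ge p : y p != M -> kap <= enorm (half_grad x eta q (y p)).
  move=> pM; set G := half_grad _ _ _ _.
  have : gam < - (q * dot G (M - y p)).
    have := Cq_gt_tangent x eta_gt0 q_gt1 i0 (z := M) (y := y p).
    rewrite eq_sym => /(_ pM); have := gap p; rewrite /C -/G.
    by move: (Cq _ _ _ _) (Cq _ _ _ _) (q * dot _ _) => a b c; lra.
  rewrite -mulrN -dotNr opprB => gG.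
  have : q * dot G (y p - M) <= q * (enorm G * (2 * L)).
    rewrite ler_pM2l// (le_trans (dot_le _ _))//.
    by rewrite ler_wpM2l ?enorm_ge0.
  rewrite /kap ler_pdivrMr ?mulr_gt0// => /(le_trans (ltW gG)).
  by rewrite mulrCA.
have [N0 offd] := eventually_off_data.
have pM p : y p != M.
  by apply/eqP => e; have := gap p; rewrite e; lra.
set W := total_weight eta q; have W0 : 0 < W := total_weight_gt0 q eta_gt0 i0.
pose step p := enorm (y p.+1 - y p).
have GE p : (N0 <= p)%N ->
    enorm (half_grad x eta q (y p)) = mass x eta q (y p) * step p.
  move=> /offd yx; rewrite -(mass_T1 q eta_gt0 i0 yx) -(proj1 (y_step p) yx) enormZ.
  by rewrite gtr0_norm ?(mass_gt0 q eta_gt0 i0)// -(enormN (y p - _)) opprB.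
(* By [GE] one factor mass times step in the descent is the gradient norm, so the decrement is at
   least linear in the step. *)
have dec p : (N0 <= p)%N -> q / 2 * kap * step p <= C (y p) - C (y p.+1).
  move=> Np; have := Cq_stepE (offd p Np); rewrite -/(step p) expr2.
  rewrite [mass _ _ _ _ * _]mulrA -GE//.
  set g := enorm _; have : q / 2 * kap * step p <= q / 2 * (g * step p).
    by rewrite -mulrA ler_pM2l ?divr_gt0// ler_wpM2r ?enorm_ge0// G_ge.
  move: (C (y p)) (C (y p.+1)) (q / 2 * kap * step p) (q / 2 * (g * step p)).
  by move=> a b c e; lra.
(* The step is gradient norm over mass, and distances at least [r] keep the mass below W r^(q -
   2). *)
have step_ge p r : (N0 <= p)%N -> 0 < r -> (forall i, r <= enorm (y p - x i)) ->
    kap / W * r `^ (2 - q) <= step p.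
  move=> Np r0 ri; have := G_ge _ (pM p); rewrite GE// => Gp.
  have := ler_wpM2r (enorm_ge0 (y p.+1 - y p)) (mass_le eta q_lt2 r0 ri).
  move/(le_trans Gp); rewrite -/W -(opprB 2 q) powRN => kr.
  have rq := powR_gt0 (2 - q) r0.
  rewrite mulrAC ler_pdivrMr// -ler_pdivlMr//.
  by rewrite (le_trans kr)// le_eqVlt; apply/orP; left; apply/eqP; rewrite /step; ring.
have step_small e : 0 < e ->
    exists2 N, (N0 <= N)%N & forall p, (N <= p)%N -> step p < e.
  move=> e0; have qk : 0 < q / 2 * kap by rewrite mulr_gt0// divr_gt0.
  have [N HN] := nonincreasing_decrement Cq_step_le (fun p => M_min (y p))
    (mulr_gt0 qk e0).
  exists (maxn N0 N) => [|p]; first exact: leq_maxl.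
  rewrite geq_max => /andP[Np N'p]; have := le_lt_trans (dec p Np) (HN p N'p).
  by rewrite ltr_pM2l.
have [s s0 sep] : exists2 s, 0 < s & forall i j, i != j -> s <= enorm (x i - x j).
  have [|s s0 Hs] := @finite_pos_lower_bound R _ [pred ij : 'I_m * 'I_m | ij.1 != ij.2]
      (fun ij => enorm (x ij.1 - x ij.2)).
    by move=> ij ne; rewrite enorm_gt0 subr_eq0 (inj_eq x_inj).
  by exists s => // i j ne; exact: (Hs (i, j)).
have q10 : 0 < q - 1 by rewrite subr_gt0.
have q20 : 0 < 2 - q by rewrite subr_gt0.
have [||t /andP[t0 t1] tq] := @powR_small R (kap / (2 * W)) (q - 1) => //.
  by rewrite divr_gt0// mulr_gt0.
(* The bound [t] will make steps at least twice [rho]; the bound [s / 4] keeps three lengths below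
   [del] from joining two distinct data points. *)
pose del := Num.min t (s / 4).
have del0 : 0 < del by rewrite lt_min t0 divr_gt0.
have dels : del <= s / 4 by rewrite /del ge_min lexx orbT.
have delq : del `^ (q - 1) <= kap / (2 * W).
  rewrite (le_trans _ tq)// ge0_ler_powR ?nnegrE ?(ltW q10) ?(ltW t0) ?(ltW del0)//.
  by rewrite /del ge_min lexx.
have [near rho_le] : exists near : nat -> 'I_m, forall p i,
    enorm (y p - x (near p)) <= enorm (y p - x i).
  exists (fun p => [arg min_(i < i0) enorm (y p - x i)]%O) => p i.
  by case: arg_minP => // j _; exact.
pose rho p := enorm (y p - x (near p)).
have rho_gt0 p : (N0 <= p)%N -> 0 < rho p.
  move=> Np; rewrite enorm_gt0 subr_eq0; apply/eqP => e.
  by apply: (offd p Np); exists (near p).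
have kW0 : 0 < kap / W by rewrite divr_gt0.
have [|N NN0 HN] := step_small (Num.min del (kap / W * del `^ (2 - q))).
  by rewrite lt_min del0 mulr_gt0// powR_gt0.
(* Small steps force small [rho], because [step_ge] bounds the step below by an increasing function
   of [rho]. *)
have rho_del p : (N <= p)%N -> rho p < del.
  move=> Np; have N0p := leq_trans NN0 Np.
  have := HN p Np; rewrite lt_min => /andP[_].
  move=> /(le_lt_trans (step_ge p _ N0p (rho_gt0 p N0p) (rho_le p))).
  rewrite ltr_pM2l// => lt; rewrite ltNge; apply/negP => le.
  move: lt; rewrite ltNge => /negP; apply.
  by rewrite ge0_ler_powR ?nnegrE ?enorm_ge0 ?(ltW q20) ?(ltW del0).
(* Repulsion: since q > 1, a small [rho] makes kap/W rho^(2 - q) exceed 2 rho. *)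
have rho_step p : (N <= p)%N -> 2 * rho p <= step p.
  move=> Np; have N0p := leq_trans NN0 Np; have r0 := rho_gt0 p N0p.
  apply: le_trans (step_ge p _ N0p r0 (rho_le p)).
  have -> : 2 * rho p = 2 * rho p `^ (q - 1) * rho p `^ (2 - q).
    rewrite -mulrA -powRD ?(gt_eqF r0) ?implybT//.
    by rewrite (_ : q - 1 + (2 - q) = 1) ?powRr1 ?(ltW r0)//; ring.
  rewrite ler_pM2r ?powR_gt0//.
  have : rho p `^ (q - 1) <= kap / (2 * W).
    apply: le_trans delq.
    by rewrite ge0_ler_powR ?nnegrE ?(ltW q10) ?(ltW r0) ?(ltW del0)// ltW// rho_del.
  move=> /(ler_wpM2l (ler0n R 2)) /le_trans; apply.
  by rewrite le_eqVlt; apply/orP; left; apply/eqP; field; rewrite gt_eqF.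
(* With the same nearest data point before and after, the triangle inequality gives a new distance
   of at least [step p - rho p], which is at least [rho p]. *)
have rhoS p : (N <= p)%N -> rho p <= rho p.+1.
  move=> Np; have r1 := rho_del p Np; have r2 := rho_del p.+1 (leqW Np).
  have := HN p Np; rewrite lt_min => /andP[sd _].
  have st := rho_step p Np.
  have near_eq : near p.+1 = near p.
    apply/eqP; apply/negPn/negP => ne.
    have := sep _ _ ne.
    have -> : x (near p.+1) - x (near p) =
      - (y p.+1 - x (near p.+1)) + ((y p.+1 - y p) + (y p - x (near p))).
      by rewrite subrKA opprB addrA subrK.
    have := enorm_triangle (- (y p.+1 - x (near p.+1)))
      ((y p.+1 - y p) + (y p - x (near p))).
    have := enorm_triangle (y p.+1 - y p) (y p - x (near p)).
    rewrite enormN -/(rho p) -/(rho p.+1) -/(step p) => h1 h2 h3.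
    by clear -h1 h2 h3 r1 r2 sd dels s0; lra.
  have := enorm_triangle (y p.+1 - x (near p)) (- (y p - x (near p))).
  rewrite opprB subrKA -(opprB (y p) (x _)) enormN.
  by move: st; rewrite /rho /step near_eq; lra.
have rho_ge p : (N <= p)%N -> rho N <= rho p.
  move=> /subnK <-; elim: (p - N)%N => [//|n IH].
  by rewrite (le_trans IH)// addSn rhoS// leq_addl.
have rN := rho_gt0 N NN0.
(* Since [rho] stays above [rho N], the steps stay above a positive constant, although they tend to
   zero. *)
have [|N' N0N' HN'] := step_small (kap / W * rho N `^ (2 - q)).
  by rewrite mulr_gt0// powR_gt0.
have := HN' (maxn N N') (leq_maxr _ _).
rewrite ltNge => /negP; apply; apply: step_ge => //.
  by rewrite (leq_trans N0N')// leq_maxr.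
by move=> i; rewrite (le_trans _ (rho_le _ i))// rho_ge// leq_maxl.
Qed.

(** Some iterate has cost below [C M + gam]; by monotonicity so do all later ones, and [Cq_gap]
    turns this into distance less than [e] from [M]. *)
Lemma iter_cvg : (fun p => enorm (y p - M)) @ \oo --> (0 : R).
Proof.
have GM := min_half_grad eta_gt0 q_gt1 q_lt2 M_min.
apply/cvgrPdist_lt => e e0.
have [gam gam0 Hgam] := Cq_gap eta_gt0 q_gt1 q_lt2 i0 (C (y 0%N)) GM e0.
have [p0 yp0] : exists p, ~ (C M + gam <= C (y p)).
  by apply/existsNP; exact: cost_gap_absurd.
exists p0 => // p /= p0p; rewrite sub0r normrN ger0_norm ?enorm_ge0//.
rewrite ltNge; apply/negP => /(Hgam _ (Cq_iter_le (leq0n p))) g; apply: yp0.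
exact: le_trans (Cq_iter_le p0p).
Qed.

End Iteration.

Theorem theorem4 (R : realType) (d m : nat)
  (x : 'I_m -> 'rV[R]_d) (eta : 'I_m -> R) (q : R) (M : 'rV[R]_d)
  (y : nat -> 'rV[R]_d) :
  injective x ->
  ~ on_common_line x ->
  (forall i, 0 < eta i) ->
  1 < q -> q < 2 ->
  (forall z, Cq q x eta M <= Cq q x eta z) ->
  (forall p, y p <> M -> qPWAWS_step q x eta (y p) (y p.+1)) ->
  ((forall p, y p <> M) ->
     (fun p => enorm (y p - M)) @ \oo --> (0 : R)) /\
  (forall p, y p = M ->
     (~ is_data_point x (y p) /\ T1 q x eta (y p) = y p) \/
     (exists k, y p = x k /\ gradDq q x eta k = 0)).
Proof.
move=> x_inj x_line eta_gt0 q_gt1 q_lt2 M_min y_step.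
(* An empty family lies on a common line vacuously, so non-collinearity supplies an index. *)
have i0 : 'I_m.
  case: (m) x x_line {x_inj M_min y_step} => [x []|n _ _]; last exact: ord0.
  by exists 0, 0 => -[].
split=> [yM|p ->]; last exact: (min_detected eta_gt0 q_gt1 q_lt2 i0).
by apply: (iter_cvg i0 x_inj eta_gt0 q_gt1 q_lt2 M_min) => p; exact: y_step.
Qed.
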